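(* There is a one-to-one correspondence between the set of permutations with no $\eta$-inactive sites and the set of primitive ascent sequences.
   Context: For a permutation $\pi$ of $[n]$ and $i\in[n]$, let $J(i)=0$ if $\pi(i)=1$ and otherwise let $J(i)$ be the index with $\pi(J(i))=\pi(i)-1$. The sites of $\pi$ are the site before $\pi(1)$ and the site after $\pi(i)$ for each $i\in[n]$. The site before $\pi(1)$ is $\eta$-active; the site after $\pi(i)$ is $\eta$-active iff $J(i)<i$, or $i<n$ and $\pi(i)<\pi(i+1)$. A site that is not $\eta$-active is $\eta$-inactive. An ascent sequence of length $n$ is a sequence $x(1)\cdots x(n)$ of positive integers with $x(1)=1$ and $x(i+1)\le 2+\mathrm{asc}(x(1)\cdots x(i))$ for each $i\in[n-1]$, where $\mathrm{asc}(w)$ is the number of indices $k$ with $w(k)<w(k+1)$. An ascent sequence is primitive if it has no flat step, i.e. no $i$ with $x(i)=x(i+1)$. *)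

(* Defs.v *)
From mathcomp Require Import all_boot all_fingroup.
Set Implicit Arguments. Unset Strict Implicit. Unset Printing Implicit Defensive.

(* A permutation pi of [n] is encoded by s : 'S_n with 0-based positions and
   values: position i (0-based) stands for i+1 and pi(i+1) = (s i) + 1. *)

(* The site after pi(i) is eta-active iff J(i) < i, or i < n and
   pi(i) < pi(i+1).  J(i) = 0 (< i always) when pi(i) = 1; otherwise J(i)
   is the position j with pi(j) = pi(i) - 1. *)
Definition eta_active_after (n : nat) (s : 'S_n) (i : 'I_n) : bool :=
  [|| val (s i) == 0,
      [exists j : 'I_n, ((val (s j)).+1 == val (s i)) && (val j < val i)]
    | [exists j : 'I_n, (val j == (val i).+1) && (val (s i) < val (s j))]].

(* The site before pi(1) is always active, so pi has no eta-inactive site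
   iff every site after some pi(i) is active. *)
Definition no_eta_inactive (n : nat) (s : 'S_n) : bool :=
  [forall i : 'I_n, eta_active_after s i].

Definition asc (w : seq nat) : nat :=
  \sum_(k < (size w).-1) (nth 0 w k < nth 0 w k.+1).

(* Ascent sequences of length n (1-based x(1..n) = nth 0 x 0 .. nth 0 x (n-1)). *)
Definition ascent_seq (n : nat) (x : seq nat) : bool :=
  [&& size x == n,
      all (fun a => 0 < a) x,
      (0 < n) ==> (nth 0 x 0 == 1)
    & [forall i : 'I_n, (0 < val i) ==> (nth 0 x i <= 2 + asc (take i x))]].

Definition primitive (x : seq nat) : bool :=
  [forall k : 'I_(size x).-1, nth 0 x k != nth 0 x k.+1].

Definition prim_ascent_seq (n : nat) (x : seq nat) : bool :=
  ascent_seq n x && primitive x.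

(* Main.v *)
Require Import Defs.
From mathcomp Require Import all_boot all_fingroup.
From mathcomp Require Import zify.
Set Implicit Arguments. Unset Strict Implicit. Unset Printing Implicit Defensive.

(** A permutation has no eta-inactive site iff every descent top a has a - 1 to
its left. Deleting the last entry (and standardizing) preserves this property;
conversely, a last entry v can be appended (raising the values >= v by one)
exactly when v is a new maximum or an ascent bottom. With a ascents and j
admissible values below the last entry, appending the admissible value of rank
r <= a leads to (a, r) if r < j and to (a + 1, r + 1) otherwise. A primitive
ascent sequence with a ascents and last letter j + 1 has extensions following
the same rule, so both families grow along isomorphic generating trees. *)

(** * Generating trees and the succession rule *)

Fixpoint level (grow : seq nat -> nat -> seq nat) (ch : seq nat -> seq nat)
    (n : nat) : seq (seq nat) :=
  if n is m.+1 then [seq grow x v | x <- level grow ch m, v <- ch x]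
  else [:: [::]].

Lemma mem_level grow ch (Q : nat -> seq nat -> Prop) :
    (forall x, Q 0 x <-> x = [::]) ->
    (forall n y, Q n.+1 y <->
       exists x v, [/\ Q n x, v \in ch x & y = grow x v]) ->
  forall n y, y \in level grow ch n <-> Q n y.
Proof.
move=> Q0 QS; elim=> [|n IHn] y /=.
  by rewrite inE Q0; split=> /eqP.
rewrite QS; split=> [/allpairsPdep|] [x [v [xn vx ->]]].
  by exists x, v; split=> //; apply/IHn.
by apply/allpairsPdep; exists x, v; split=> //; apply/IHn.
Qed.

Lemma level_uniq grow ch n :
    (forall m x, x \in level grow ch m -> uniq (ch x)) ->
    (forall x y u v, grow x u = grow y v -> x = y /\ u = v) ->
  uniq (level grow ch n).
Proof.
move=> chU growI; elim: n => //= n IHn.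
apply: allpairs_uniq_dep => //; first exact: chU.
by move=> [x u] [y v] _ _ /= /growI[-> ->].
Qed.

Definition kid (s : nat * nat) (r : nat) : nat * nat :=
  if r < s.2 then (s.1, r) else (s.1.+1, r.+1).

Definition kids (s : nat * nat) : seq (nat * nat) :=
  [seq kid s r | r <- iota 0 s.1.+1].

Fixpoint state_level (n : nat) : seq (nat * nat) :=
  if n is m.+1 then flatten [seq kids s | s <- state_level m]
  else [:: (0, 1)].

(** The states of the children depend only on the state of the parent, so by induction the multiset
    of states at depth [n] is fixed by the rule. Two trees obeying [kids] therefore have levels of
    equal size. *)
Lemma perm_state_level grow ch (st : seq nat -> nat * nat) n :
    st [::] = (0, 1) ->
    (forall m x, x \in level grow ch m ->
       perm_eq [seq st (grow x v) | v <- ch x] (kids (st x))) ->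
  perm_eq [seq st x | x <- level grow ch n] (state_level n).
Proof.
move=> st0 stS; elim: n => [|n IHn] /=; first by rewrite st0.
rewrite map_allpairs.
apply: (@perm_trans _ (flatten [seq kids s | s <- [seq st x | x <- level grow ch n]])).
  rewrite -map_comp; elim: (level grow ch n) (stS n) => //= x l IHl stx.
  apply: (perm_cat (s2 := kids (st x))); first by apply: stx; rewrite inE eqxx.
  by apply: IHl => y yl; apply: stx; rewrite inE yl orbT.
exact/perm_flatten/perm_map.
Qed.

(** * Ascents and ascent bottoms of a word *)

(* At the last letter [head 0 [::] = 0] makes the test false. *)
Fixpoint asc_bots (w : seq nat) : seq nat :=
  if w is a :: t then
    if a < head 0 t then a :: asc_bots t else asc_bots t
  else [::].

Lemma asc_bots_rcons w v :
  asc_bots (rcons w v) =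
  if last v w < v then rcons (asc_bots w) (last v w) else asc_bots w.
Proof.
case: w => [|a w] /=; first by rewrite ltnn.
elim: w a => [|b w IHw] a //; move: (IHw b) => /= ->.
by case: ltnP => // _; case: ltnP.
Qed.

Lemma size_asc_bots w : size (asc_bots w) = asc w.
Proof.
rewrite /asc; case: w => [|a w] /=; first by rewrite big_ord0.
elim: w a => [|b w IHw] a /=; first by rewrite big_ord0.
by rewrite big_ord_recl -IHw /=; case: ltnP.
Qed.

Lemma asc_rcons w v : asc (rcons w v) = asc w + (last v w < v).
Proof.
rewrite -!size_asc_bots asc_bots_rcons.
by case: ltnP; rewrite ?size_rcons ?addn1 ?addn0.
Qed.

Lemma asc_bots_map_bump v w :
  asc_bots (map (bump v) w) = map (bump v) (asc_bots w).
Proof.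
elim: w => //= a [|b w] //= ->.
by rewrite ltnNge leq_bump2 -ltnNge; case: ltnP.
Qed.

Lemma asc_bots_subseq w : subseq (asc_bots w) w.
Proof.
elim: w => // a w IHw; rewrite [asc_bots _]/=; case: ltnP => _.
  by rewrite /= eqxx.
exact: subseq_trans IHw (subseq_cons _ _).
Qed.

(** Without repeated letters, the only occurrence of [a] decides whether it is an ascent bottom. *)
Lemma mem_asc_bots u a b t :
  uniq (u ++ a :: b :: t) -> (a \in asc_bots (u ++ a :: b :: t)) = (a < b).
Proof.
have sub y s : y \notin s -> y \notin asc_bots s.
  by apply: contra; apply/mem_subseq/asc_bots_subseq.
elim: u => [|c u IHu].
  move=> /= /andP[/sub aN _]; case: ltnP => _; first by rewrite inE eqxx.
  exact: negbTE.
rewrite cat_cons cons_uniq => /andP[cN uU]; rewrite -(IHu uU).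
have ca: a != c by apply: contraNneq cN => <-; rewrite mem_cat inE eqxx orbT.
by rewrite /=; case: ltnP => // _; rewrite inE (negbTE ca).
Qed.

Lemma last_notin_asc_bots u a :
  uniq (rcons u a) -> a \notin asc_bots (rcons u a).
Proof.
rewrite asc_bots_rcons rcons_uniq => /andP[aN _].
have aN' : a \notin asc_bots u.
  by apply: contra aN; apply/mem_subseq/asc_bots_subseq.
case: ltnP => //; rewrite mem_rcons inE (negbTE aN') orbF => lt_a.
by rewrite neq_ltn lt_a orbT.
Qed.

(** * Permutation words and the appending of a last entry *)

Definition perm_word (n : nat) (w : seq nat) : bool :=
  [&& size w == n, uniq w & all (gtn n) w].

(** Only the site inside a descent can be inactive: the last site is active because every other
    value lies to the left of the last entry. A descent top is positive, so [a.-1] is a true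
    predecessor. *)
Definition good (w : seq nat) : Prop :=
  forall u a b t, w = u ++ a :: b :: t -> b < a -> a.-1 \in u.

Definition good_word (n : nat) (w : seq nat) : Prop := perm_word n w /\ good w.

Definition append (w : seq nat) (v : nat) : seq nat :=
  rcons (map (bump v) w) v.

Definition choices (w : seq nat) : seq nat := rcons (asc_bots w) (size w).

Lemma mem_perm_word n w k : perm_word n w -> (k \in w) = (k < n).
Proof.
case/and3P=> /eqP szw wU /allP wn.
have sub : {subset w <= iota 0 n} by move=> a /wn /=; rewrite mem_iota.
have [|_ ->] := uniq_min_size wU sub; first by rewrite size_iota szw.
by rewrite mem_iota.
Qed.

Lemma bump_inj v : injective (bump v).
Proof. exact: can_inj (bumpK v). Qed.

Lemma bump_notin v (w : seq nat) : v \notin map (bump v) w.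
Proof. by apply/mapP=> -[a _] /eqP; rewrite (negbTE (neq_bump v a)). Qed.

Lemma perm_word_append n w v :
  v <= n -> perm_word n.+1 (append w v) = perm_word n w.
Proof.
move=> le_vn; rewrite /perm_word /append size_rcons size_map eqSS.
rewrite rcons_uniq bump_notin (map_inj_uniq (@bump_inj v)) all_rcons /=.
rewrite ltnS le_vn all_map; congr [&& _, _ & _]; apply: eq_all => a /=.
by rewrite /bump; lia.
Qed.

Lemma good_rcons w v :
  good (rcons w v) <->
  good w /\ (forall u p, w = rcons u p -> v < p -> p.-1 \in u).
Proof.
split=> [wvG|[wG vG] u a b t].
  split=> [u a b t wE | u p wE].
    by apply: (wvG u a b (rcons t v)); rewrite wE rcons_cat.
  by apply: (wvG u p v [::]); rewrite wE -!cats1 -catA.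
case/lastP: t => [|t x].
  rewrite -cat_rcons cats1 => /rcons_inj[wE <-].
  exact: vG.
rewrite -!rcons_cons -rcons_cat => /rcons_inj[wE _].
exact: wG wE.
Qed.

Lemma map_eq_cat2 (f : nat -> nat) w u a b t :
  map f w = u ++ a :: b :: t ->
  exists u' a' b' t',
    [/\ w = u' ++ a' :: b' :: t', u = map f u', a = f a' & b = f b'].
Proof.
elim: u w => [|c u IHu] [|a' w] //=.
  by case: w => //= b' t' [<- <- _]; exists [::], a', b', t'.
case=> <- /IHu[u' [d [e [t' [-> -> -> ->]]]]].
by exists (a' :: u'), d, e, t'.
Qed.

(** An admissible value is an ascent bottom or the new maximum [n]; a descent top is neither. *)
Lemma choicesP n u a b t v :
  perm_word n (u ++ a :: b :: t) -> v \in choices (u ++ a :: b :: t) ->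
  b < a -> v != a.
Proof.
move=> wP; have /and3P[/eqP szw wU _] := wP.
have : a \in u ++ a :: b :: t by rewrite mem_cat inE eqxx orbT.
rewrite (mem_perm_word _ wP) /choices mem_rcons inE szw => lt_an vC lt_ba.
apply/eqP => va; move: vC; rewrite va mem_asc_bots //.
by lia.
Qed.

Lemma choices_last n u p v :
  perm_word n (rcons u p) -> v \in choices (rcons u p) -> v != p.
Proof.
move=> wP; have /and3P[/eqP szw wU _] := wP.
have : p \in rcons u p by rewrite mem_rcons inE eqxx.
rewrite (mem_perm_word _ wP) /choices mem_rcons inE szw => lt_pn vC.
apply/eqP => vp; move: vC; rewrite vp (negbTE (last_notin_asc_bots wU)).
by lia.
Qed.

(** Raising the values from [v] on separates only the consecutive pair [v.-1], [v]. *)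
Lemma bump_pred v a : 0 < a -> v != a -> (bump v a).-1 = bump v a.-1.
Proof. by rewrite /bump => a0 /eqP va; lia. Qed.

Lemma bump_predI v a c : 0 < a -> (bump v a).-1 = bump v c -> v != a /\ c = a.-1.
Proof. by rewrite /bump => a0 va; split; [apply/eqP|]; lia. Qed.

(** Old descents keep the predecessors of their tops on the left, since [v] is not a descent top. If
    the old last entry becomes a descent top, all other old values already lie to its left. *)
Lemma good_append n w v :
  good_word n w -> v \in choices w -> good (append w v).
Proof.
move=> [wP wG] vC; apply/good_rcons; split=> [u a b t | u p].
  case/map_eq_cat2=> u' [a' [b' [t' [wE -> -> ->]]]].
  rewrite ltnNge leq_bump2 -ltnNge => lt_ba.
  rewrite wE in wP vC; rewrite bump_pred ?(choicesP wP vC) //; last by lia.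
  exact/map_f/(wG _ _ _ _ wE).
case/lastP: w wP wG vC => [|u' p'] wP wG vC; first by case: u.
have vp := choices_last wP vC.
rewrite map_rcons => /rcons_inj[<- <-] lt_vp.
have {lt_vp} : v < p' by move: lt_vp vp; rewrite /bump; lia.
move=> lt_vp; rewrite bump_pred //; last by lia.
apply: map_f; have : p' \in rcons u' p' by rewrite mem_rcons inE eqxx.
rewrite (mem_perm_word _ wP) => lt_pn.
have : p'.-1 \in rcons u' p' by rewrite (mem_perm_word _ wP); lia.
by rewrite mem_rcons inE => /orP[/eqP|//]; lia.
Qed.

(** If [v < n] is not an ascent bottom, it is the last entry of [w] or a descent top. Appending [v]
    turns it into the descent top [v.+1], whose predecessor [v] now stands at the very end and not
    to its left. *)
Lemma good_unappend n w v :
    perm_word n w -> v <= n -> good (append w v) ->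
  good w /\ v \in choices w.
Proof.
move=> wP le_vn /good_rcons[wG vG]; split.
  move=> u a b t wE lt_ba.
  have : (bump v a).-1 \in map (bump v) u.
    apply: (wG _ _ (bump v b) (map (bump v) t)); first by rewrite wE map_cat.
    by rewrite ltnNge leq_bump2 -ltnNge.
  by case/mapP=> c cu /bump_predI[|_ <-] //; lia.
have /and3P[/eqP szw wU _] := wP.
rewrite /choices mem_rcons inE szw; case: eqP => //= v_n.
have [u [t wE]] : exists u t, w = u ++ v :: t.
  have : v \in w by rewrite (mem_perm_word _ wP); lia.
  by case/path.splitPr=> u t; exists u, t.
have bv : bump v v = v.+1 by rewrite /bump leqnn.
case: t wE => [|b t] wE.
  have : (bump v v).-1 \in map (bump v) u.
    by apply: vG; rewrite ?bv // wE map_cat cats1 /= bv.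
  by rewrite bv (negbTE (bump_notin v u)).
rewrite wE mem_asc_bots -?wE // ltnNge; apply/negP => le_bv.
have : (bump v v).-1 \in map (bump v) u.
  apply: (wG _ _ (bump v b) (map (bump v) t)); first by rewrite wE map_cat.
  rewrite ltnNge leq_bump2 -ltnNge ltn_neqAle le_bv andbT.
  by apply: contraTneq wU => vb; rewrite wE vb cat_uniq /= inE eqxx !andbF.
by rewrite bv (negbTE (bump_notin v u)).
Qed.

(** * Succession rule for permutation words *)

(* The default [1] gives the empty word the state [(0, 1)], for which the
   succession rule [kid] remains correct; likewise [2] in [seq_state]. *)
Definition word_state (w : seq nat) : nat * nat :=
  (size (asc_bots w), count (gtn (last 1 w)) (choices w)).

Lemma choices_uniq n w : perm_word n w -> uniq (choices w).
Proof.
move=> wP; have /and3P[/eqP szw wU _] := wP.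
rewrite /choices rcons_uniq (subseq_uniq (asc_bots_subseq w) wU) andbT.
apply/negP => /(mem_subseq (asc_bots_subseq w)).
by rewrite (mem_perm_word _ wP) szw ltnn.
Qed.

Lemma choices_le n w v : perm_word n w -> v \in choices w -> v <= n.
Proof.
move=> wP; have /and3P[/eqP szw _ _] := wP.
rewrite /choices mem_rcons inE szw => /predU1P[-> //|].
by move/(mem_subseq (asc_bots_subseq w)); rewrite (mem_perm_word _ wP) => /ltnW.
Qed.

(** When [u < v], the member [u] is counted below [v] but not below itself, so ranks of members
    compare as the members do. *)
Lemma ltn_count_gtn (s : seq nat) u v :
  u \in s -> (count (gtn u) s < count (gtn v) s) = (u < v).
Proof.
move=> us; case: (ltnP u v) => [lt_uv|le_vu].
  elim: s us => //= a s IHs; rewrite inE => /predU1P[<-|/IHs]; last by lia.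
  rewrite ltnn lt_uv add0n add1n ltnS; apply: sub_count => a' /= lt_a'u.
  exact: ltn_trans lt_uv.
apply/negbTE; rewrite -leqNgt; apply: sub_count => a' /= lt_a'v.
exact: leq_trans le_vu.
Qed.

(** Bumping leaves the number of ascent bottoms below [v] unchanged. If [v] exceeds the last entry,
    that entry becomes one more ascent bottom below [v], which adds one to both components. *)
Lemma word_state_append n w v :
  perm_word n w -> v \in choices w ->
  word_state (append w v) =
  kid (word_state w) (count (gtn v) (choices w)).
Proof.
move=> wP vC; have le_vn := choices_le wP vC.
have /and3P[/eqP szw _ _] := wP.
rewrite /kid /word_state ltn_count_gtn //= last_rcons.
rewrite /choices size_rcons size_map szw asc_bots_rcons asc_bots_map_bump.
have count_bump s : count (gtn v) (map (bump v) s) = count (gtn v) s.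
  by rewrite count_map; apply: eq_count => a /=; rewrite /bump; lia.
(* Bumping does not affect whether the last entry is below [v]. On the empty word [v = 0], and both
   tests are false with their respective defaults. *)
have [lt_lastE lastN] : (last v (map (bump v) w) < v) = (last 1 w < v)
    /\ last 1 w != v.
  case/lastP: w wP szw vC {count_bump} => [|u p] wP szw vC.
    by move: vC; rewrite /choices /= inE => /eqP ->.
  rewrite map_rcons !last_rcons eq_sym (choices_last wP vC).
  by split=> //; rewrite /bump; lia.
rewrite lt_lastE; case: (ltngtP v (last 1 w)) lt_lastE lastN => // lt_v.
  rewrite size_map -!cats1 !count_cat count_bump /=.
  by move=> _ _; congr (_, _); lia.
move=> lt_last _; rewrite -!cats1 size_cat size_map !count_cat count_bump /= lt_last.
by congr (_, _); lia.
Qed.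

(** The ranks of distinct choices are distinct and smaller than the number of choices, so they fill
    the whole interval. *)
Lemma choices_rank n w :
  perm_word n w ->
  perm_eq [seq count (gtn v) (choices w) | v <- choices w]
    (iota 0 (size (asc_bots w)).+1).
Proof.
move=> wP; set C := choices w.
have rU : uniq [seq count (gtn v) C | v <- C].
  rewrite map_inj_in_uniq ?(choices_uniq wP) // => u v uC vC ruv.
  have := ltn_count_gtn v uC; have := ltn_count_gtn u vC.
  by rewrite ruv ltnn; lia.
have sub : {subset [seq count (gtn v) C | v <- C] <= iota 0 (size (asc_bots w)).+1}.
  move=> _ /mapP[v vC ->]; rewrite mem_iota /= add0n -(size_rcons _ (size w)).
  by apply: (@leq_trans (count (gtn v.+1) C)); rewrite ?ltn_count_gtn ?count_size.
have [|_ rE] := uniq_min_size rU sub; first by rewrite size_iota size_map size_rcons.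
exact/uniq_perm/rE/iota_uniq.
Qed.

Lemma append_inj x y u v : append x u = append y v -> x = y /\ u = v.
Proof.
move=> /rcons_inj[+ uv]; rewrite -uv => /(inj_map (@bump_inj u)) ->.
by [].
Qed.

Lemma good_word_succ n y :
  good_word n.+1 y <->
  exists w v, [/\ good_word n w, v \in choices w & y = append w v].
Proof.
split=> [[]|[w [v [wG vC ->]]]]; last first.
  split; last exact: good_append wG vC.
  have [wP _] := wG; have /and3P[/eqP szw wU _] := wP.
  rewrite perm_word_append //; move: vC; rewrite /choices mem_rcons inE szw.
  case: eqP => [-> //|_ /= /(mem_subseq (asc_bots_subseq w))].
  by rewrite (mem_perm_word _ wP); lia.
case/lastP: y => [|y v] yP yG; first by move/and3P: yP => [].
have /and3P[_ + /allP yn] := yP; rewrite rcons_uniq => /andP[vy _].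
(* The value [v] does not occur in [y], so standardizing by [unbump v] loses nothing. *)
have yE : y = map (bump v) (map (unbump v) y).
  rewrite -map_comp -[LHS]map_id; apply/eq_in_map => a ay /=.
  by rewrite unbumpK // inE; apply: contraNneq vy => <-.
have le_vn : v <= n by have := yn v; rewrite mem_rcons inE eqxx /=; apply.
move: yP yG; have -> : rcons y v = append (map (unbump v) y) v by rewrite /append -yE.
rewrite perm_word_append // => wP.
case/(good_unappend wP le_vn) => wG vC.
by exists (map (unbump v) y), v; split.
Qed.

(** * Succession rule for primitive ascent sequences *)

(** For an ascent sequence, these are the letters [1, ..., 2 + asc x] other than the last one,
    listed by rank. On the empty sequence the default [2] leaves just the letter [1]. *)
Definition bump_letters (x : seq nat) : seq nat :=
  [seq bump (last 2 x) r.+1 | r <- iota 0 (asc x).+1].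

Definition seq_state (x : seq nat) : nat * nat := (asc x, (last 2 x).-1).

(** The letter of rank [r] is [r.+1] if that is below the last letter, giving no ascent; otherwise
    it is [r.+2] and creates an ascent. *)
Lemma seq_state_rcons x r :
  r <= asc x ->
  seq_state (rcons x (bump (last 2 x) r.+1)) = kid (seq_state x) r.
Proof.
rewrite /seq_state /kid last_rcons asc_rcons /=.
case/lastP: x => [|x l].
  by rewrite {1}/asc big_ord0 leqn0 /asc big_ord0 => /eqP ->.
rewrite !last_rcons /bump => _; case: (ltnP r l.-1) => lt_rl; congr (_, _); lia.
Qed.

Lemma ascent_seq_rcons n x v :
  ascent_seq n.+1 (rcons x v) =
  [&& ascent_seq n x, 0 < v & if n is 0 then v == 1 else v <= 2 + asc x].
Proof.
rewrite /ascent_seq size_rcons eqSS all_rcons /= nth_rcons.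
case: eqP => //= szx; rewrite szx.
case: (all _ x); rewrite ?andbF //= andbT.
have take_rconsl i : i <= n -> take i (rcons x v) = take i x.
  by move=> le_in; rewrite -cats1 takel_cat ?szx.
apply/and3P/and3P => [[v0 x1 /forallP xn]|[/andP[x1 /forallP xn] v0 vn]]; split=> //.
- apply/andP; split.
    by apply/implyP=> n0; move: x1; rewrite n0.
  apply/forallP=> i; have /= := xn (widen_ord (leqnSn n) i).
  by rewrite nth_rcons szx ltn_ord take_rconsl // ltnW.
- case: n szx x1 xn take_rconsl => [|n] szx x1 xn take_rconsl //.
  have /= := xn ord_max.
  by rewrite nth_rcons szx ltnn eqxx take_rconsl // -{1}szx take_size.
- by case: n szx x1 vn {xn take_rconsl}.
apply/forallP=> i; rewrite nth_rcons szx.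
have [lt_in|le_ni] := ltnP i n.
  by rewrite take_rconsl ?(ltnW lt_in) //; apply: (xn (Ordinal lt_in)).
have -> : val i = n by apply/eqP; rewrite eqn_leq le_ni -ltnS ltn_ord.
by rewrite eqxx take_rconsl // -{2}szx take_size; case: n vn {xn szx x1 i le_ni take_rconsl}.
Qed.

Lemma primitive_rcons x v :
  primitive (rcons x v) = primitive x && (last v.+1 x != v).
Proof.
(* Having no flat step means being sorted for the relation [!=], which makes the path lemmas
   available. *)
have primE y : primitive y = sorted (fun a b => a != b) y.
  apply/forallP/(sortedP 0) => [yP i lt_iy | yP k].
    have lt_i : i < (size y).-1 by lia.
    exact: (yP (Ordinal lt_i)).
  by apply: yP; have := ltn_ord k; lia.
rewrite !primE; case: x => [|a x] /=; first by rewrite neq_ltn ltnSn orbT.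
by rewrite rcons_path.
Qed.

Lemma mem_bump_letters n x v :
  ascent_seq n x ->
  v \in bump_letters x =
  [&& 0 < v, v != last 2 x & if n is 0 then v == 1 else v <= 2 + asc x].
Proof.
case/and4P=> /eqP szx /allP x0 x1 /forallP xn.
case/lastP: x => [|x l] in szx x0 x1 xn *.
  by rewrite -szx /bump_letters /asc big_ord0 inE; case: v => [|[|[|v]]].
rewrite size_rcons in szx; rewrite -szx in x1 xn *.
have l0 : 0 < l by apply: x0; rewrite mem_rcons inE eqxx.
(* The last letter itself lies in the allowed range, so skipping it leaves exactly [asc + 1]
   ranks. *)
have le_l : l <= 2 + asc (rcons x l).
  have := xn ord_max; rewrite /= nth_rcons ltnn eqxx -cats1 takel_cat //.
  rewrite take_size cats1 asc_rcons.
  case: (x) x1 => [/eqP /= ->|a y _ /leq_trans] //; apply; lia.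
rewrite last_rcons; apply/mapP/and3P => [[r + ->]|[v0 vl le_v]].
  rewrite mem_iota last_rcons /bump => /andP[_ le_r]; split; lia.
have lt_uv : 0 < unbump l v <= (asc (rcons x l)).+1.
  by move: vl => /eqP; rewrite /unbump; lia.
exists (unbump l v).-1; first by rewrite mem_iota; lia.
by rewrite last_rcons prednK ?unbumpK //; case/andP: lt_uv.
Qed.

Lemma prim_ascent_seq_succ n y :
  prim_ascent_seq n.+1 y <->
  exists x v, [/\ prim_ascent_seq n x, v \in bump_letters x & y = rcons x v].
Proof.
have step x v : prim_ascent_seq n.+1 (rcons x v) =
    prim_ascent_seq n x && (v \in bump_letters x).
  rewrite /prim_ascent_seq ascent_seq_rcons primitive_rcons.
  case xA : (ascent_seq n x) => //=; rewrite (mem_bump_letters _ xA).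
  case: (primitive x); rewrite ?andbF //= -andbA [last _ _ == _]eq_sym.
  case/and4P: xA => /eqP + _ _ _; case: x => [<-|a x _] /=.
    by case: v => [|[|[|v]]]; rewrite ?andbF.
  by congr (_ && _); rewrite andbC.
split=> [|[x [v [xP vx ->]]]]; last by rewrite step xP.
case/lastP: y => [/andP[/and4P[]]//|x v]; rewrite step => /andP[xP vx].
by exists x, v.
Qed.

(** * Permutations with no inactive site as good words *)

Definition word (n : nat) (s : 'S_n) : seq nat := [seq val (s i) | i <- enum 'I_n].

Lemma word_inj n : injective (@word n).
Proof.
move=> s t /eq_in_map st; apply/permP => i; apply/val_inj/st.
by rewrite mem_enum.
Qed.

Lemma nth_word n (s : 'S_n) (i : 'I_n) : nth 0 (word s) i = s i.
Proof. by rewrite (nth_map i) ?size_enum_ord // nth_ord_enum. Qed.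

Lemma size_word n (s : 'S_n) : size (word s) = n.
Proof. by rewrite size_map size_enum_ord. Qed.

Lemma word_surj n w : perm_word n w -> exists s : 'S_n, word s = w.
Proof.
case/and3P=> /eqP szw wU /allP wn.
have lt_w (i : 'I_n) : nth 0 w i < n by apply/wn/mem_nth; rewrite szw.
have wI : injective (fun i : 'I_n => Ordinal (lt_w i)).
  move=> i j [/eqP]; rewrite nth_uniq ?szw // => /eqP.
  exact: val_inj.
exists (perm wI); apply: (@eq_from_nth _ 0); first by rewrite size_word szw.
rewrite size_word => i lt_in.
by rewrite (nth_word _ (Ordinal lt_in)) permE.
Qed.

Lemma perm_word_word n (s : 'S_n) : perm_word n (word s).
Proof.
rewrite /perm_word size_word eqxx /= map_inj_uniq ?enum_uniq.
  by apply/allP=> _ /mapP[i _ ->] /=.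
by move=> i j /val_inj/perm_inj.
Qed.

Lemma no_eta_inactiveP n (s : 'S_n) : no_eta_inactive s <-> good (word s).
Proof.
split=> [/forallP sA u a b t sE lt_ba | sG].
  have := size_word s; rewrite sE size_cat /= => szE.
  have lt_u : size u < n by lia.
  have lt_u1 : (size u).+1 < n by lia.
  have sa : s (Ordinal lt_u) = a :> nat.
    by rewrite -nth_word sE nth_cat ltnn subnn.
  have sb : s (Ordinal lt_u1) = b :> nat.
    by rewrite -nth_word sE nth_cat ltnNge leqnSn /= subSnn.
  case/or3P: (sA (Ordinal lt_u)); rewrite /= sa.
  - by move=> /eqP a0; rewrite a0 in lt_ba.
  - case/existsP=> j /andP[/eqP <- lt_ju] /=.
    by rewrite -nth_word sE nth_cat lt_ju mem_nth.
  case/existsP=> j /andP[/eqP j_u lt_aj].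
  have jE : j = Ordinal lt_u1 by apply: val_inj.
  by rewrite jE sb in lt_aj; lia.
apply/forallP=> i; rewrite /eta_active_after /=.
case: (posnP (s i)) => [->//|si0].
have [lt_in|le_ni] := ltnP i.+1 n; apply/or3P; last first.
  (* At the last position, the value [(s i).-1] occurs elsewhere and hence to the left. *)
  have lt_sn : (s i).-1 < n by apply: leq_ltn_trans (leq_pred _) (ltn_ord _).
  apply: Or32; apply/existsP; exists (s^-1 (Ordinal lt_sn))%g.
  rewrite permKV /= prednK // eqxx /=.
  have : (s^-1 (Ordinal lt_sn))%g != i.
    by apply/eqP=> /(congr1 s); rewrite permKV => /(congr1 val) /=; lia.
  rewrite -val_eqE /=; have := ltn_ord (s^-1 (Ordinal lt_sn))%g; lia.
have [lt_s|le_s] := ltnP (s i) (s (Ordinal lt_in)).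
  by apply: Or33; apply/existsP; exists (Ordinal lt_in); rewrite eqxx.
have lt_s : s (Ordinal lt_in) < s i.
  rewrite ltn_neqAle le_s andbT; apply/eqP=> /val_inj/perm_inj/(congr1 val) /=.
  by lia.
(* Position [i] is now a descent, so goodness applies to the splitting of the word there. *)
have : (s i).-1 \in take i (word s).
  apply: (sG _ _ (s (Ordinal lt_in)) (drop i.+2 (word s))) => //.
  rewrite -!nth_word /= -!drop_nth ?size_word ?cat_take_drop //.
case/(nthP 0)=> k; rewrite size_takel ?size_word ?(ltnW (ltn_ord i)) // => lt_ki.
rewrite nth_take // => kE; have lt_kn := ltn_trans lt_ki (ltn_ord i).
apply: Or32; apply/existsP; exists (Ordinal lt_kn).
by rewrite -(nth_word s (Ordinal lt_kn)) /= kE prednK ?eqxx.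
Qed.

(** * From equal counts to a bijection *)

(** The ambient type may be infinite, as [seq nat] is, so a duplicate-free list of the members
    serves to number them by position. *)
Lemma sub_bij_ord (A : eqType) (P : pred A) (e : seq A) :
    uniq e -> e =i P ->
  exists f : {x | P x} -> 'I_(size e), bijective f.
Proof.
move=> eU eP.
have ltf (x : {x | P x}) : index (val x) e < size e.
  by rewrite index_mem eP; exact: (valP x).
have gP (i : 'I_(size e)) : P (tnth (in_tuple e) i).
  by rewrite -[P _]eP mem_tnth.
exists (fun x => Ordinal (ltf x)), (fun i => exist P _ (gP i)) => [x|i].
  apply/val_inj; rewrite /= (tnth_nth (val x)) /= nth_index // eP.
  exact: (valP x).
by apply/val_inj; rewrite /= (tnth_nth (tnth (in_tuple e) i)) index_uniq.
Qed.

Lemma sub_bij (A B : eqType) (P : pred A) (Q : pred B) (e : seq A) (d : seq B) :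
    uniq e -> e =i P -> uniq d -> d =i Q -> size e = size d ->
  exists f : {x | P x} -> {y | Q y}, bijective f.
Proof.
move=> eU eP dU dQ szE.
have [f fB] := sub_bij_ord eU eP; rewrite szE in f fB.
have [g [h gK hK]] := sub_bij_ord dU dQ.
by exists (h \o f); apply: bij_comp => //; exists g.
Qed.

Theorem theorem7p10 (n : nat) :
  exists f : {s : 'S_n | no_eta_inactive s} -> {x : seq nat | prim_ascent_seq n x},
    bijective f.
Proof.
have good_mem : forall m w, w \in level append choices m <-> good_word m w.
  apply: mem_level good_word_succ => w; split=> [[/andP[/nilP]]//|->].
  by split=> // -[].
have seq_mem : forall m x, x \in level rcons bump_letters m <-> prim_ascent_seq m x.
  apply: mem_level prim_ascent_seq_succ => x; split.
    by case/andP => /andP[/nilP].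
  by move=> ->; apply/andP; split; [apply/and4P; split=> //|]; apply/forallP=> -[].
have goodU : uniq (level append choices n).
  apply: level_uniq append_inj => m x /good_mem[xP _].
  exact: choices_uniq xP.
have seqU : uniq (level rcons bump_letters n).
  apply: level_uniq => [m x _ | x y u v /rcons_inj[]//].
  rewrite map_inj_uniq ?iota_uniq // => r t /bump_inj[].
  exact.
apply: (@sub_bij _ _ _ _ [seq s <- enum 'S_n | no_eta_inactive s] _ _ _ seqU).
- by rewrite filter_uniq ?enum_uniq.
- by move=> s; rewrite mem_filter mem_enum andbT.
- by move=> x; apply/idP/idP => /seq_mem.
(* Passing to words identifies the permutations with no inactive site with level [n] of the tree of
   good words. *)
transitivity (size (level append choices n)).
  rewrite -(size_map (@word n)); apply/perm_size/uniq_perm => //.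
    by rewrite (map_inj_uniq (@word_inj n)) filter_uniq ?enum_uniq.
  move=> w; apply/mapP/idP => [[s + ->]|/good_mem[wP wG]].
    rewrite mem_filter => /andP[/no_eta_inactiveP sG _]; apply/good_mem.
    by split=> //; apply: perm_word_word.
  have [s sE] := word_surj wP; exists s => //.
  by rewrite mem_filter mem_enum andbT; apply/no_eta_inactiveP; rewrite sE.
(* Both levels have the same multiset of states, [state_level n], hence the same size. *)
rewrite -(size_map word_state) -[RHS](size_map seq_state).
apply: perm_size; apply: (@perm_trans _ (state_level n)).
  apply: perm_state_level => // m x /good_mem[xP _].
  have -> : [seq word_state (append x v) | v <- choices x] =
      [seq kid (word_state x) r |
         r <- [seq count (gtn v) (choices x) | v <- choices x]].
    by rewrite -map_comp; apply/eq_in_map => v; apply: word_state_append xP.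
  exact/perm_map/choices_rank/xP.
rewrite perm_sym; apply: perm_state_level => [|m x _].
  by rewrite /seq_state /asc big_ord0.
rewrite /bump_letters /kids -map_comp.
have -> // : [seq (seq_state \o rcons x \o bump (last 2 x) \o succn) r
         | r <- iota 0 (asc x).+1] = [seq kid (seq_state x) r | r <- iota 0 (asc x).+1].
apply/eq_in_map => r; rewrite mem_iota /= add0n ltnS => le_r.
exact: seq_state_rcons.
Qed.
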